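(* Let $A\in\mathcal{L}(\mathcal{H})$ and let $B\in\mathcal{L}(\mathcal{H})$ be a Hermitian operator with closed range. If $A\overset{*}{\leq}B$ then $(AB)^\dagger=B^\dagger A^\dagger$.
   Context: $\mathcal{H}$ is a complex Hilbert space, $\mathcal{L}(\mathcal{H})$ is the algebra of bounded linear operators on $\mathcal{H}$, and $\mathcal{R}(T)$, $\mathcal{N}(T)$ denote range and nullspace. The Moore-Penrose inverse of $T\in\mathcal{L}(\mathcal{H})$ is the (in general densely defined, unbounded) operator $T^\dagger:\mathcal{R}(T)\oplus\mathcal{R}(T)^\perp\to\mathcal{H}$ with $T^\dagger|_{\mathcal{R}(T)}=(T|_{\mathcal{N}(T)^\perp})^{-1}$ (where $T|_{\mathcal{N}(T)^\perp}:\mathcal{N}(T)^\perp\to\mathcal{R}(T)$) and $\mathcal{N}(T^\dagger)=\mathcal{R}(T)^\perp$; $T^\dagger\in\mathcal{L}(\mathcal{H})$ if and only if $\mathcal{R}(T)$ is closed. Star order: $A\overset{*}{\leq}B$ if $A^*A=A^*B$ and $AA^*=BA^*$. *)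

(* Defs.v *)
From HB Require Import structures.
From mathcomp Require Import all_boot all_order all_algebra.
From mathcomp Require Import complex.
From mathcomp Require Import all_classical all_reals all_analysis.

Set Implicit Arguments.
Unset Strict Implicit.
Unset Printing Implicit Defensive.

Import Order.TTheory GRing.Theory Num.Theory.
Import numFieldNormedType.Exports.

Local Open Scope classical_set_scope.
Local Open Scope ring_scope.
Local Open Scope complex_scope.

Section Operators.
Variables (R : realType) (H : completeNormedModType R[i]).
Variable (dot : {dot H for Num.conj}).
Implicit Types (A B T : {linear H -> H}) (S : set H) (F G : set (H * H)).

(* With [H] complete, this makes [(H, dot)] a complex Hilbert space. *)
Definition induces_norm : Prop := forall x : H, `|x| ^+ 2 = dot x x.

Definition bounded_op T : Prop := exists M : R[i], forall x, `|T x| <= M * `|x|.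

(* For bounded [T] the vector [z] exists by Riesz's theorem and is unique; the
   default value [0] only matters for unbounded [T]. *)
Definition adjoint T : H -> H :=
  fun y => xget 0 [set z | forall x, dot (T x) y = dot x z].

Definition self_adjoint T : Prop := adjoint T = T.

Definition star_le A B : Prop :=
  adjoint A \o A = adjoint A \o B /\ A \o adjoint A = B \o adjoint A.

Definition nullspace T : set H := [set x | T x = 0].

Definition orthocomp S : set H := [set x | forall y, S y -> dot x y = 0].

(* Possibly unbounded operators are represented by their graphs, so that
   equality includes equality of domains. In [G \; F], [F] is applied first. *)
Definition graph_comp G F : set (H * H) := (G \; F)%relation.

Definition restr_graph T S : set (H * H) :=
  [set p | S p.1 /\ p.2 = T p.1].

(* Graph of [(T|_{N(T)^perp})^-1], with domain R(T). *)
Definition restr_inv T : set (H * H) :=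
  ((restr_graph T (orthocomp (nullspace T)))^-1)%relation.

(* Linear extension of [restr_inv T] by [0] on R(T)^perp. *)
Definition mp_inverse T : set (H * H) :=
  [set p | exists y z, [/\ restr_inv T (y, p.2), orthocomp (range T) z & p.1 = y + z]].

Lemma orthocompB S x y : orthocomp S x -> orthocomp S y -> orthocomp S (x - y).
Proof.
move=> hx hy z Sz; transitivity (dot x z - dot y z); first exact: linearBl.
by rewrite hx// hy// subrr.
Qed.

Lemma orthocompI S x : S x -> orthocomp S x -> x = 0.
Proof. by move=> Sx /(_ _ Sx)/eqP; rewrite dnorm_eq0 => /eqP. Qed.

Lemma mp_inverse_functional T w x1 x2 :
  mp_inverse T (w, x1) -> mp_inverse T (w, x2) -> x1 = x2.
Proof.
move=> [y1 [z1 [[/= n1 ->] o1 ->]]] [y2 [z2 [[/= n2 ->] o2 /= e]]].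
have e0 : T (x1 - x2) = z2 - z1.
  by rewrite linearB/= -[T x1](addrK z1) e addrAC (addrC (T x2)) addrK.
have z0 : T (x1 - x2) = 0.
  by apply: (@orthocompI (range T)); [exists (x1 - x2)|rewrite e0; exact: orthocompB].
by apply/eqP; rewrite -subr_eq0; apply/eqP/(@orthocompI (nullspace T))=> //; exact: orthocompB.
Qed.

Lemma mp_inverse_range T x : orthocomp (nullspace T) x -> mp_inverse T (T x, x).
Proof.
move=> nx; exists (T x), 0; split=> //=; last by rewrite addr0.
by move=> y _; rewrite linear0l.
Qed.

Lemma mp_inverse_nullspace T : [set w | mp_inverse T (w, 0)] = orthocomp (range T).
Proof.
apply/seteqP; split=> [w [y [z [[/= _ ->] oz ->]]]|w ow] /=.
  by rewrite linear0 add0r.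
exists 0, w; split=> //=; last by rewrite add0r.
by split=> [y _|] /=; rewrite ?linear0l ?linear0.
Qed.

End Operators.

(* Main.v *)
Require Import Defs.
From mathcomp Require Import all_boot all_order all_algebra.
From mathcomp Require Import complex ring.
From mathcomp Require Import all_classical all_reals all_analysis.

(** Write [A'] for the adjoint of [A].  The star order hypotheses
    [A' A = A' B] and [A A' = B A'], together with the symmetry of [B], give
    [A B = A A'] by taking adjoints in the second one ([mulAB]).  The
    range of [A B] is then as large as that of [A] in the sense that both have
    the same orthogonal complement ([orthocomp_range_AB]), since
    [A A' z = 0] forces [A' z = 0].

    A pair [(w, u)] lies in the graph of the pseudoinverse of [T] exactly when
    [u] is orthogonal to [N(T)] and [w - T u] is orthogonal to [R(T)]
    ([mp_inverseP]).  With this description the theorem compares two systems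
    of orthogonality conditions.  On the right-hand side the intermediate
    vector [x] must be [B u]: it is orthogonal to [N(A)], which contains
    [N(B)], while [x - B u] is orthogonal to [R(B)], hence in [N(B)].
    It remains to see that [u] is orthogonal to [N(A B)] iff [u] is
    orthogonal to [N(B)] and [B u] is orthogonal to [N(A)]
    ([orthocomp_ker_AB]).  The closed range of [B] enters only here, to split
    a vector of [N(A B)] along [R(B)] and [N(B)].

    Both the orthogonal splitting and the existence of adjoints come from one
    form of Riesz's theorem ([riesz]): on a closed subspace [S], a
    bounded functional [f] is [dot _ p] for some [p] in [S].  The vector
    [p] is the limit of approximate minimizers of
    [dot s s - 2 Re (f s)] over [S]. *)

Set Implicit Arguments.
Unset Strict Implicit.
Unset Printing Implicit Defensive.

Import Order.TTheory GRing.Theory Num.Theory.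
Import numFieldNormedType.Exports.

Local Open Scope classical_set_scope.
Local Open Scope ring_scope.
Local Open Scope complex_scope.

(** * Inner product and norm *)

Section InnerProduct.
Variables (R : realType) (H : completeNormedModType R[i]).
Variable (dot : {dot H for Num.conj}).
Implicit Types (T : {linear H -> H}) (S : set H) (f : H -> R[i]).

Lemma dotC x y : dot x y = Num.conj (dot y x).
Proof. by rewrite hermC /= expr0 mul1r. Qed.

Lemma dotC_eq0 x y : dot x y = 0 -> dot y x = 0.
Proof. by move=> xy0; rewrite dotC xy0 rmorph0. Qed.

Lemma dot_ext x y : (forall v, dot v x = dot v y) -> x = y.
Proof.
by move=> xy; apply/eqP; rewrite -subr_eq0 -(dnorm_eq0 dot) linearBr/= xy subrr.
Qed.

Hypothesis dot_norm : induces_norm dot.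

Lemma cauchy_schwarz x y : `|dot x y| <= `|x| * `|y|.
Proof.
have [->|y0] := eqVneq y 0; first by rewrite linear0r !normr0 mulr0.
have yy0 : 0 < dot y y by rewrite dnorm_gt0.
rewrite -(@ler_pXn2r _ 2) ?nnegrE ?mulr_ge0 // exprMn !dot_norm -subr_ge0.
(* [dot y y] times the defect is the squared norm of this combination. *)
rewrite -(pmulr_lge0 _ yy0).
have := dnorm_ge0 dot (dot y y *: x - dot x y *: y).
rewrite dnormB !dnormZ linearZl_LR linearZr_LR/= !normCK !rmorphM /=.
rewrite conjCK -!(dotC y y).
by congr (0 <= _); ring.
Qed.

(** * Riesz representation on a closed subspace *)

Definition subspace S : Prop :=
  S 0 /\ forall c u v, S u -> S v -> S (u + c *: v).

(** When [f] is represented by [p], this is [|s - p|^2 - |p|^2], so its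
    minimizer is [p]; being stated without [p] it can be used to find [p]. *)
Definition energy f s := dot s s - (f s + Num.conj (f s)).

(** Real-valuedness, in the form that transfers comparisons to [R]. *)
Lemma energyE f s : energy f s = (complex.Re (energy f s))%:C.
Proof.
rewrite [RHS]RRe_real //; apply: rpredB; first by rewrite ger0_real ?dnorm_ge0.
by rewrite CrealE rmorphD /= conjCK addrC.
Qed.

Lemma energyDZ f s v c : scalar f ->
  energy f (s + c *: v) = energy f s + c * Num.conj c * dot v v
    - (c * (f v - dot v s) + Num.conj (c * (f v - dot v s))).
Proof.
move=> flin; rewrite /energy [s + _]addrC flin dnormD dnormZ
  linearZl_LR/= normCK.
rewrite !(rmorphD, rmorphM, rmorphN) /=.
ring.
Qed.

Lemma energy_ge f s (M : R[i]) :
  0 <= M -> `|f s| <= M * `|s| -> - M ^+ 2 <= energy f s.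
Proof.
move=> M0 fM.
have h : f s + Num.conj (f s) <= 2 * (M * `|s|).
  apply: (le_trans (real_ler_norm _)).
    by rewrite CrealE rmorphD /= conjCK addrC.
  apply: (le_trans (ler_normD _ _)).
  by rewrite norm_conjC mulr_natl mulr2n lerD.
rewrite /energy -dot_norm lerBrDr -lerBrDl opprK; apply: (le_trans h).
rewrite -subr_ge0.
have -> : `|s| ^+ 2 + M ^+ 2 - 2 * (M * `|s|) = (`|s| - M) ^+ 2 by ring.
by rewrite real_exprn_even_ge0 // rpredB ?ger0_real.
Qed.

(** If [s] minimizes the energy on [S] up to [e ^+ 2], a move from [s] along
    [v] cannot gain more than that; the best such move gains
    [|f v - dot v s|^2 / |v|^2]. *)
Lemma riesz_approx f S (M e : R[i]) : scalar f ->
  0 <= M -> (forall x, `|f x| <= M * `|x|) -> subspace S -> 0 < e ->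
  exists2 s, S s & forall v, S v -> `|f v - dot v s| <= e * `|v|.
Proof.
move=> flin M0 fM [S0 SDZ] e0.
pose E := [set complex.Re (energy f s) | s in S].
have Einf : has_inf E.
  split; first by exists (complex.Re (energy f 0)), 0.
  exists (complex.Re (- M ^+ 2)) => _ [s Ss <-].
  by have := energy_ge M0 (fM s); rewrite lecE => /andP[].
have e2r : e ^+ 2 = (complex.Re (e ^+ 2))%:C.
  by rewrite RRe_real // ger0_real // exprn_ge0 // ltW.
have e20 : 0 < complex.Re (e ^+ 2).
  by have := exprn_gt0 2 e0; rewrite {1}e2r ltcR.
have [_ [s Ss <-] lts] := inf_adherent e20 Einf.
exists s => // v Sv.
have [->|v0] := eqVneq v 0.
  by rewrite linear0l normr0 mulr0 subr0; have := fM 0; rewrite normr0 mulr0.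
have vv0 : 0 < dot v v by rewrite dnorm_gt0.
set g := f v - dot v s.
(* The step [c = g^* / |v|^2] minimizes [energyDZ] over [c]. *)
have : energy f s <= energy f (s + (Num.conj g / dot v v) *: v) + e ^+ 2.
  rewrite energyE [X in _ <= X + _]energyE e2r -rmorphD /= lecR.
  apply: (le_trans (ltW lts)); rewrite lerD2r; apply: ge_inf; first exact: Einf.2.
  by exists (s + (Num.conj g / dot v v) *: v) => //; apply: SDZ.
rewrite energyDZ // -/g -addrA -addrA lerDl => gain.
rewrite -(@ler_pXn2r _ 2) ?nnegrE ?mulr_ge0 // ?(ltW e0) //.
rewrite exprMn dot_norm normCK -subr_ge0.
move: gain; rewrite !rmorphM /= fmorphV /= -!(dotC v v) conjCK.
rewrite -(pmulr_lge0 _ vv0).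
by congr (0 <= _); field; exact: lt0r_neq0.
Qed.

(** Approximate representatives [s m] and [s n] are close: the difference of
    their defects at [v = s m - s n] is [|v|^2].  Completeness then gives an
    exact one. *)
Theorem riesz f S (M : R[i]) : scalar f ->
  0 <= M -> (forall x, `|f x| <= M * `|x|) -> subspace S -> closed S ->
  exists2 p, S p & forall v, S v -> f v = dot v p.
Proof.
move=> flin M0 fM Ssub Sclosed.
have eps0 n : 0 < n.+1%:R^-1 :> R[i] by rewrite invr_gt0 ltr0n.
have /boolp.choice[s sP] n :
    exists s, S s /\ forall v, S v -> `|f v - dot v s| <= n.+1%:R^-1 * `|v|.
  by have [s] := riesz_approx flin M0 fM Ssub (eps0 n); exists s.
have eps_cvg (e : R[i]) : 0 < e ->
  exists N : nat, forall n, (N <= n)%N -> n.+1%:R^-1 < e.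
  move=> e0.
  have er : e = (complex.Re e)%:C by rewrite RRe_real // gtr0_real.
  move: e0; rewrite er ltcR => e0.
  have [N] := ltr_add_invr e0; rewrite add0r => hN; exists N => n le_Nn.
  rewrite -(rmorph_nat (real_complex R)) -fmorphV /= ltcR; apply: le_lt_trans hN.
  by rewrite lef_pV2 ?posrE ?ltr0n // ler_nat.
have s_close m n : `|s m - s n| <= m.+1%:R^-1 + n.+1%:R^-1.
  have [->|d0] := eqVneq (s m - s n) 0; first by rewrite normr0 addr_ge0 // ltW.
  have Sd : S (s m - s n).
    by rewrite -scaleN1r; apply: Ssub.2; [exact: (sP m).1|exact: (sP n).1].
  rewrite -(@ler_pM2r _ `|s m - s n|) ?normr_gt0 // -expr2 dot_norm.
  rewrite linearBr /= mulrDl.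
  rewrite -[X in X <= _]ger0_norm; last by rewrite -linearBr dnorm_ge0.
  rewrite (_ : dot _ (s m) - _ =
    (f (s m - s n) - dot (s m - s n) (s n))
    - (f (s m - s n) - dot (s m - s n) (s m))); last by ring.
  apply: (le_trans (ler_normB _ _)); rewrite addrC.
  by apply: lerD; [exact: (sP m).2|exact: (sP n).2].
have /cauchy_cvgP s_cvg : cauchy (s @ \oo).
  apply: cauchy_exP => e e0.
  have [N hN] := eps_cvg (e / 2) (divr_gt0 e0 (ltr0n _ 2)).
  exists (s N); exists N => // n /= le_Nn.
  rewrite -ball_normE /=; apply: (le_lt_trans (s_close _ _)).
  by rewrite [e]splitr ltrD // hN.
have /cvg_ex[/= p s_p] := s_cvg.
exists p.
  apply: (@closed_cvg _ _ _ _ s S Sclosed _ p s_p).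
  by near=> n; exact: (sP n).1.
move=> v Sv.
apply/eqP; rewrite -subr_eq0 -normr_le0; apply/ler_addgt0Pl => e e0; rewrite addr0.
(* [+ 1] avoids dividing by zero when [v = 0]. *)
pose d := e / (2 * (`|v| + 1)).
have d0 : 0 < d by rewrite divr_gt0 // mulr_gt0 // ltr_wpDl.
have [N hN] := eps_cvg d d0.
have [n le_Nn sn_p] : exists2 n, (N <= n)%N & `|p - s n| < d.
  have : \forall n \near \oo, (N <= n)%N /\ `|p - s n| < d.
    by near=> n; split; near: n; [exists N|move/cvgrPdist_lt: s_p; apply].
  by case=> K _ /(_ K (leqnn K)) []; exists K.
have -> : f v - dot v p = (f v - dot v (s n)) - dot v (p - s n).
  by rewrite linearBr /=; ring.
apply: (le_trans (ler_normB _ _)).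
have -> : e = d * (`|v| + 1) + (`|v| + 1) * d.
  by rewrite /d; field; rewrite lt0r_neq0 // ltr_wpDl.
apply: lerD.
  by apply: (le_trans ((sP n).2 _ Sv)); rewrite ler_pM ?lerDl // ltW // hN.
by apply: (le_trans (cauchy_schwarz _ _)); rewrite ler_pM ?lerDl // ltW.
Unshelve. all: by end_near.
Qed.

(** The projection of [x] on [S] represents the functional [dot^~ x] on [S]. *)
Lemma orthogonal_decomposition S x : subspace S -> closed S ->
  exists2 p, S p & orthocomp dot S (x - p).
Proof.
move=> Ssub Sclosed.
have [||p Sp pP] := @riesz (dot^~ x) S `|x| _ (normr_ge0 x) _ Ssub Sclosed.
- by move=> a u v; rewrite linearPl.
- by move=> v; rewrite mulrC; exact: cauchy_schwarz.
exists p => // v Sv; apply: dotC_eq0.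
by rewrite linearBr /= pP // subrr.
Qed.

(** * Adjoints and pseudoinverses *)

(** By Riesz's theorem on the whole space the default value in the definition
    of [adjoint] is never taken. *)
Lemma adjointP T x y : bounded_op T -> dot (T x) y = dot x (adjoint dot T y).
Proof.
move=> [M TM].
have normM z : `|T z| <= `|M| * `|z|.
  by rewrite -[`|z|]normr_id -normrM ger0_norm ?(le_trans (normr_ge0 _) (TM z)).
have setT_sub : subspace [set: H] by [].
have [||z _ zP] := @riesz (fun x => dot (T x) y) setT (`|M| * `|y|)
  _ (mulr_ge0 (normr_ge0 _) (normr_ge0 _)) _ setT_sub closedT.
- by move=> a u v; rewrite linearP linearPl.
- move=> v; apply: (le_trans (cauchy_schwarz _ _)).
  by rewrite mulrAC ler_wpM2r.
suff /(xgetPex 0) : exists z, [set z | forall x, dot (T x) y = dot x z] z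
  by exact.
by exists z => v; exact: zP.
Qed.

Lemma subspace_range T : subspace (range T).
Proof.
split; first by exists 0; rewrite ?linear0.
by move=> c _ _ [u _ <-] [v _ <-]; exists (u + c *: v); rewrite ?linearD ?linearZ.
Qed.

(** The two summands of [w] in the definition are determined by [w] and [u],
    so the graph is cut out by orthogonality conditions alone. *)
Lemma mp_inverseP T w u : mp_inverse dot T (w, u) <->
  orthocomp dot (nullspace T) u /\ orthocomp dot (range T) (w - T u).
Proof.
split=> [[y [z [[/= uN ->] zR ->]]]|[uN zR]]; first by rewrite addrC addKr.
by exists (T u), (w - T u); split=> //; rewrite /= addrC subrK.
Qed.

(** * Kernels and ranges under the star order *)

Section StarOrder.
(* [A'] is kept as a plain function: its linearity follows from [adjA]. *)
Variables (A B : {linear H -> H}) (A' : H -> H).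
Hypothesis adjA : forall x y, dot (A x) y = dot x (A' y).
Hypothesis symB : forall x y, dot (B x) y = dot x (B y).
Hypothesis starl : forall x, A' (A x) = A' (B x).
Hypothesis starr : forall y, A (A' y) = B (A' y).

Lemma adjA' x y : dot (A' x) y = dot x (A y).
Proof. by rewrite dotC -adjA -dotC. Qed.

Lemma adj0 : A' 0 = 0.
Proof. by apply: dot_ext => v; rewrite -adjA !linear0r. Qed.

(** The adjoint of [A A' = B A'], whose left-hand side is its own adjoint. *)
Lemma mulAB x : A (B x) = A (A' x).
Proof.
by apply: dot_ext => v; rewrite -[LHS]adjA' -[RHS]adjA' -symB -starr adjA.
Qed.

Lemma ker_AadjA y : A (A' y) = 0 -> A' y = 0.
Proof.
move=> AA'y; apply/eqP; rewrite -(dnorm_eq0 dot); apply/eqP.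
by rewrite adjA' AA'y linear0r.
Qed.

Lemma ker_adjAA x : A' (A x) = 0 -> A x = 0.
Proof.
move=> A'Ax; apply/eqP; rewrite -(dnorm_eq0 dot); apply/eqP.
by rewrite adjA A'Ax linear0r.
Qed.

Lemma ker_B_sub x : B x = 0 -> A x = 0.
Proof. by move=> Bx; apply: ker_adjAA; rewrite starl Bx adj0. Qed.

(** If [z] is orthogonal to the range of [A B = A A'], then [A A' z = 0] because
    [A A'] is symmetric; hence [A' z = 0], which is orthogonality to [R(A)]. *)
Lemma orthocomp_range_AB :
  orthocomp dot (range (A \o B)) = orthocomp dot (range A).
Proof.
apply/seteqP; split=> z zP _ [v _ <-] /=; last by apply: zP; exists (B v).
apply: dotC_eq0; rewrite adjA.
suff -> : A' z = 0 by rewrite linear0r.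
apply/ker_AadjA/dot_ext => w.
rewrite linear0r -adjA' -adjA -mulAB; apply: dotC_eq0; apply: zP.
by exists w.
Qed.

(** [B] maps [N(A)] into [N(A B)], which gives the direct implication.
    Conversely [N(A B) = N(A')] is the sum of [N(B)] and [B (N(A))]: split [v]
    in [N(A B)] as [B s + n] with [n] in [N(B)]; both [v] and [n] are killed by
    [A'], so [A' A s = A' B s = 0] and [A s = 0]. *)
Lemma orthocomp_ker_AB u : closed (range B) ->
  orthocomp dot (nullspace (A \o B)) u <->
  orthocomp dot (nullspace B) u /\ orthocomp dot (nullspace A) (B u).
Proof.
move=> Bclosed; split=> [uP|[uB BuA] v ABv].
  split=> v /= v0; first by apply: uP; rewrite /nullspace /= v0 linear0.
  rewrite symB; apply: uP; rewrite /nullspace /= mulAB -starl v0.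
  by rewrite adj0 linear0.
have A'v : A' v = 0 by apply: ker_AadjA; rewrite -mulAB.
have [_ [s _ <-] nP] := orthogonal_decomposition v (subspace_range B) Bclosed.
set n := v - B s in nP.
have Bn : B n = 0.
  apply: dot_ext => w; rewrite linear0r -symB.
  by apply: dotC_eq0; apply: nP; exists w.
have A'n : A' n = 0 by apply: ker_AadjA; rewrite -mulAB Bn linear0.
have As : A s = 0.
  apply: ker_adjAA; rewrite starl; apply: dot_ext => w.
  rewrite linear0r -adjA (_ : B s = v - n); last by rewrite /n opprB addrC subrK.
  by rewrite linearBr /= !adjA A'v A'n linear0r subrr.
rewrite (_ : v = B s + n); last by rewrite /n addrC subrK.
by rewrite linearDr /= -symB (BuA _ As) (uB _ Bn) addr0.
Qed.

Lemma mp_inverse_AB : closed (range B) ->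
  mp_inverse dot (A \o B) = graph_comp (mp_inverse dot B) (mp_inverse dot A).
Proof.
move=> Bclosed; apply/seteqP; split=> -[w u].
  move=> /mp_inverseP[/(orthocomp_ker_AB _ Bclosed)[uB BuA]].
  rewrite orthocomp_range_AB => zR.
  exists (B u); apply/mp_inverseP => //=; split=> //.
  by rewrite subrr => v _; rewrite linear0l.
move=> [x /= /mp_inverseP[xA zR] /mp_inverseP[uB zB]].
(* [x - B u] lies both in [N(B)] and in its orthogonal complement. *)
have xBu : x = B u.
  have ker_diff : B (x - B u) = 0.
    apply: dot_ext => v; rewrite linear0r -symB.
    by apply: dotC_eq0; apply: zB; exists v.
  apply/eqP; rewrite -subr_eq0; apply/eqP.
  apply: (orthocompI (dot := dot) (S := nullspace B)) => //.
  apply: orthocompB => v Bv; first by apply: xA; exact: ker_B_sub.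
  by rewrite symB Bv linear0r.
rewrite xBu in xA zR; apply/mp_inverseP; rewrite orthocomp_range_AB; split=> //.
exact/orthocomp_ker_AB.
Qed.

End StarOrder.

End InnerProduct.

Theorem proposition5p8 (R : realType) (H : completeNormedModType R[i])
    (dot : {dot H for Num.conj}) (A B : {linear H -> H}) :
  induces_norm dot ->
  bounded_op A -> bounded_op B ->
  self_adjoint dot B -> closed (range B) ->
  star_le dot A B ->
  mp_inverse dot (A \o B) = graph_comp (mp_inverse dot B) (mp_inverse dot A).
Proof.
move=> dot_norm bA bB sB cB [starl starr].
apply: (mp_inverse_AB dot_norm (A' := adjoint dot A)) => //.
- by move=> x y; exact: adjointP.
- by move=> x y; rewrite adjointP // sB.
- by move=> x; exact: (congr1 (@^~ x) starl).
- by move=> x; exact: (congr1 (@^~ x) starr).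
Qed.
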